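(* Let $(G,T,\ell,u,w)$ be a PESP instance, let $\Gamma$ be the cycle matrix of an integral cycle basis $B$ of $G$, and let $\mathcal P=\{(x,z)\in\mathbb R^A\times\mathbb R^B\mid\Gamma x=Tz,\ \ell\le x\le u\}$, with $z$ the integer variables. Then the Chvátal closure of $\mathcal P$ is $$\mathcal P_{\mathrm{Ch}}=\{(x,z)\in\mathcal P\mid (x,z)\text{ satisfies the cycle inequality for all }\gamma\in\mathcal C\},$$ where the cycle inequality for $\gamma\in\mathcal C$ is $$\left\lceil\frac{\gamma_+^\top\ell-\gamma_-^\top u}{T}\right\rceil\le\frac{\gamma^\top x}{T}\le\left\lfloor\frac{\gamma_+^\top u-\gamma_-^\top\ell}{T}\right\rfloor.$$
   Context: A PESP instance $(G,T,\ell,u,w)$ consists of a finite weakly connected directed graph $G=(V,A)$, a period $T\in\mathbb N$, $T\ge 2$, bounds $\ell,u\in\mathbb Z^A$ and weights $w\in\mathbb R^A$. The cycle space is $\mathcal C=\{\gamma\in\mathbb Z^A \mid \sum_{a\in\delta^+(i)}\gamma_a=\sum_{a\in\delta^-(i)}\gamma_a\ \forall i\in V\}$, of rank $\mu=|A|-|V|+1$. For $\gamma\in\mathcal C$, $\gamma_+=\max(\gamma,0)$ and $\gamma_-=\max(-\gamma,0)$ componentwise. An oriented cycle is an element of $\mathcal C\cap\{-1,0,1\}^A$. An integral cycle basis is a set $B$ of $\mu$ oriented cycles forming a $\mathbb Z$-basis of $\mathcal C$; its cycle matrix $\Gamma\in\{-1,0,1\}^{B\times A}$ has the elements of $B$ as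 rows. For a polyhedron $P\subseteq\mathbb R^n\times\mathbb R^p$ with variables $(x,z)$, $z$ being the integer variables, and $(\beta,\beta_0)\in\mathbb Z^p\times\mathbb Z$, put $$P^{(\beta,\beta_0)}=\operatorname{conv}(\{(x,z)\in P\mid\beta^\top z\le\beta_0\}\cup\{(x,z)\in P\mid\beta^\top z\ge\beta_0+1\}).$$ The Chvátal closure of $P$ is $$P_{\mathrm{Ch}}=\bigcap\{P^{(\beta,\beta_0)}\mid(\beta,\beta_0)\in\mathbb Z^p\times\mathbb Z\text{ such that }P\cap\{\beta^\top z\le\beta_0\}=\emptyset\text{ or }P\cap\{\beta^\top z\ge\beta_0+1\}=\emptyset\}.$$ *)

(* Defs.v *)
From HB Require Import structures.
From mathcomp Require Import all_boot all_order all_algebra finmap.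
From mathcomp Require Import mathcomp_extra boolp classical_sets reals convex.

Set Implicit Arguments.
Unset Strict Implicit.
Unset Printing Implicit Defensive.

Import Order.TTheory GRing.Theory Num.Theory.

Local Open Scope classical_set_scope.
Local Open Scope ring_scope.

(* R^o rather than R, so that the R-module structure is inferred. *)
Notation rvec R I := {ffun I -> R^o}.

Definition conv_hull (R : realType) (M : lmodType R) (S : set M) : set M :=
  smallest (@convex_set R M) S.

Section ChvatalClosure.
Context (R : realType) (N I : finType).
Implicit Types (P : set (rvec R N * rvec R I)) (beta : {ffun I -> int}).

Definition int_form beta (z : rvec R I) : R := \sum_i (beta i)%:~R * (z i : R).

Definition below P beta (beta0 : int) : set (rvec R N * rvec R I) :=
  P `&` [set xz | int_form beta xz.2 <= beta0%:~R].

Definition above P beta (beta0 : int) : set (rvec R N * rvec R I) :=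
  P `&` [set xz | (beta0 + 1)%:~R <= int_form beta xz.2].

Definition split_hull P beta (beta0 : int) : set (rvec R N * rvec R I) :=
  conv_hull (below P beta beta0 `|` above P beta beta0).

Definition chvatal_closure P : set (rvec R N * rvec R I) :=
  \bigcap_(b in [set b : {ffun I -> int} * int |
                  below P b.1 b.2 = set0 \/ above P b.1 b.2 = set0])
    split_hull P b.1 b.2.

End ChvatalClosure.

(* Parallel arcs and loops are allowed. *)
Record digraph := Digraph {
  vertices : finType;
  arcs : finType;
  src : arcs -> vertices;
  tgt : arcs -> vertices
}.

Definition adjacent (G : digraph) : rel (vertices G) := fun i j =>
  [exists a : arcs G, ((src a == i) && (tgt a == j))
                  || ((src a == j) && (tgt a == i))].

Definition weakly_connected (G : digraph) : Prop :=
  (0 < #|vertices G|)%N /\ forall i j : vertices G, connect (@adjacent G) i j.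

Record pesp (R : realType) := PESP {
  graph : digraph;
  period : nat;
  lower : {ffun arcs graph -> int};
  upper : {ffun arcs graph -> int};
  weight : {ffun arcs graph -> R};
  graph_connected : weakly_connected graph;
  period_ge2 : (2 <= period)%N
}.

Section CycleSpace.
Context (G : digraph).
Implicit Types (gamma delta : {ffun arcs G -> int})
  (B : {fset {ffun arcs G -> int}}).

Definition cycle_space : set {ffun arcs G -> int} :=
  [set gamma | forall i : vertices G,
    \sum_(a | src a == i) gamma a = \sum_(a | tgt a == i) gamma a].

Definition cyclomatic_number : int := #|arcs G|%:Z - #|vertices G|%:Z + 1.

Definition pos_part gamma : {ffun arcs G -> int} :=
  [ffun a => Num.max (gamma a) 0].

Definition neg_part gamma : {ffun arcs G -> int} :=
  [ffun a => Num.max (- gamma a) 0].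

Definition oriented_cycle gamma : Prop :=
  cycle_space gamma /\ forall a, gamma a \in [:: -1; 0; 1].

Definition Zcomb B (c : {ffun B -> int}) : {ffun arcs G -> int} :=
  \sum_(b : B) fsval b *~ c b.

Definition integral_cycle_basis B : Prop :=
  [/\ #|` B|%:Z = cyclomatic_number,
      forall gamma, gamma \in B -> oriented_cycle gamma,
      forall gamma, cycle_space gamma ->
        exists c : {ffun B -> int}, gamma = Zcomb c
    & forall c : {ffun B -> int}, Zcomb c = 0 -> c = 0].

(* Row b of the cycle matrix. *)
Definition cycle_matrix B (b : B) : {ffun arcs G -> int} := fsval b.

Definition int_dot gamma delta : int := \sum_a gamma a * delta a.

End CycleSpace.

Section PespPolyhedron.
Context (R : realType) (X : pesp R).
Local Notation G := (graph X).

Definition pesp_polyhedron (B : {fset {ffun arcs G -> int}}) :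
    set (rvec R (arcs G) * rvec R B) :=
  [set xz : rvec R (arcs G) * rvec R B |
    (forall b : B,
      int_form (cycle_matrix b) xz.1 = (period X)%:R * (xz.2 b : R)) /\
    (forall a, (lower X a)%:~R <= (xz.1 a : R) <= (upper X a)%:~R)].

Definition cycle_inequality (gamma : {ffun arcs G -> int})
    (x : rvec R (arcs G)) : Prop :=
  let lo : int := int_dot (pos_part gamma) (lower X)
            - int_dot (neg_part gamma) (upper X) in
  let hi : int := int_dot (pos_part gamma) (upper X)
            - int_dot (neg_part gamma) (lower X) in
  (Num.ceil (lo%:~R / (period X)%:R : R))%:~R
    <= int_form gamma x / (period X)%:R
    <= (Num.floor (hi%:~R / (period X)%:R : R))%:~R.

End PespPolyhedron.

Arguments pesp_polyhedron {R} X B _.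
Arguments cycle_inequality {R} X gamma x.

(* Main.v *)
(* A split with one empty side has the other side, a half-space section of P, as its hull, so the
   Chvatal closure imposes beta.z <= beta0 exactly when P misses beta.z >= beta0 + 1.  On P one
   has beta.z = gamma.x / T with gamma the combination of the basis with coefficients beta, and
   since P projects onto the whole box l <= x <= u, the best beta0 is the floor of the maximum of
   gamma.x / T over the box.  As the basis is integral, every gamma in the cycle space arises;
   gamma and -gamma give the two halves of the cycle inequality. *)
Require Import Defs.
From HB Require Import structures.
From mathcomp Require Import all_boot all_order all_algebra finmap.
From mathcomp Require Import mathcomp_extra boolp classical_sets reals convex.
From mathcomp Require Import interval_inference.

Set Implicit Arguments.
Unset Strict Implicit.
Unset Printing Implicit Defensive.

Import Order.TTheory GRing.Theory Num.Theory.

Local Open Scope classical_set_scope.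
Local Open Scope ring_scope.

Lemma weighted_mean_le (R : numDomainType) (t a b c : R) :
  0 <= t <= 1 -> a <= c -> b <= c -> t * a + (1 - t) * b <= c.
Proof.
move=> /andP[t0 t1] ac bc; have -> : c = t * c + (1 - t) * c.
  by rewrite -mulrDl addrC subrK mul1r.
by rewrite lerD // ler_wpM2l // subr_ge0.
Qed.

Section IntForm.
Context (R : realType) (I : finType).
Implicit Types (beta : {ffun I -> int}) (x y z : rvec R I).

Lemma int_form_lincomb beta (s t : R) x y :
  int_form beta (s *: x + t *: y) = s * int_form beta x + t * int_form beta y.
Proof.
rewrite /int_form !mulr_sumr -big_split; apply: eq_bigr => i _.
by rewrite !ffunE mulrDr !mulrA ![_ * s]mulrC ![_ * t]mulrC -!mulrA.
Qed.

Lemma int_formN beta z : int_form (- beta) z = - int_form beta z.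
Proof.
by rewrite /int_form -sumrN; apply: eq_bigr => i _; rewrite ffunE mulrNz mulNr.
Qed.

End IntForm.

Section ChvatalClosure.
Context (R : realType) (N I : finType).
Implicit Types (P : set (rvec R N * rvec R I)) (beta : {ffun I -> int}).

Lemma conv_hull_id (M : lmodType R) (S : set M) :
  convex_set S -> conv_hull S = S.
Proof.
move=> cS; apply/seteqP; split; first exact: smallest_sub.
exact: sub_gen_smallest.
Qed.

(** Negation exchanges the two sides of a split: the threshold [- (beta0 + 1)] becomes [- beta0]
    once [above] adds its one. This lets a split with empty lower side be treated as one with empty
    upper side. *)
Lemma above_opp P beta (beta0 : int) :
  above P (- beta) (- (beta0 + 1)) = below P beta beta0.
Proof.
by apply/seteqP; split=> xz [Pxz /=];
  rewrite /above /= int_formN opprD subrK mulrNz lerN2; split.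
Qed.

Lemma below_opp P beta (beta0 : int) :
  below P (- beta) (- (beta0 + 1)) = above P beta beta0.
Proof.
by apply/seteqP; split=> xz [Pxz /=];
  rewrite /below /= int_formN mulrNz lerN2; split.
Qed.

Lemma convex_below P beta (beta0 : int) :
  convex_set P -> convex_set (below P beta beta0).
Proof.
move=> cP x y t; rewrite !inE => -[Px bx] [Py bly]; split.
  by apply/set_mem/cP; exact/mem_set.
rewrite /= int_form_lincomb.
by rewrite weighted_mean_le // ge0 le1.
Qed.

Lemma chvatal_closureP P (xz : rvec R N * rvec R I) : convex_set P ->
  chvatal_closure P xz <->
  P xz /\ forall beta (beta0 : int), above P beta beta0 = set0 ->
                             int_form beta xz.2 <= beta0%:~R.
Proof.
move=> cP; split=> [Cxz|[Pxz Hxz] [beta beta0] /= H].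
  have valid beta (beta0 : int) : above P beta beta0 = set0 -> below P beta beta0 xz.
    move=> aE; have := Cxz (beta, beta0) (or_intror aE).
    by rewrite /split_hull aE setU0 conv_hull_id //; exact: convex_below.
  (* The zero form never reaches 1, so this trivial split has an empty upper side; its hull gives
     membership in [P], which the intersection does not state explicitly. *)
  have a0 : above P 0 0 = set0.
    rewrite -subset0 => y [_] /=; rewrite /int_form big1 ?ler10 // => i _.
    by rewrite ffunE mul0r.
  by split=> [|beta beta0 /valid[]//]; have [] := valid _ _ a0.
(* The point already lies in the nonempty side, hence in the hull. If [below] is the empty side, the
   hypothesis is applied to [- beta]. *)
apply: sub_gen_smallest; case: H => E; [right | left].
  rewrite -above_opp in E; rewrite -below_opp; split=> //; exact: Hxz.
by split=> //; exact: Hxz.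
Qed.

End ChvatalClosure.

Section Box.
Context (G : digraph).
Implicit Types (gamma l u : {ffun arcs G -> int}).

(** For [l <= u] this is the maximum of the linear form [gamma] over the box, and [box_argmax] is a
    vertex attaining it. *)
Definition box_max l u gamma : int :=
  int_dot (pos_part gamma) u - int_dot (neg_part gamma) l.

Definition box_argmax l u gamma : {ffun arcs G -> int} :=
  [ffun a => if 0 <= gamma a then u a else l a].

Lemma pos_partN gamma : pos_part (- gamma) = neg_part gamma.
Proof. by apply/ffunP => a; rewrite !ffunE. Qed.

Lemma neg_partN gamma : neg_part (- gamma) = pos_part gamma.
Proof. by apply/ffunP => a; rewrite !ffunE opprK. Qed.

Lemma box_maxE l u gamma :
  box_max l u gamma = int_dot gamma (box_argmax l u gamma).
Proof.
rewrite /box_max /int_dot -sumrB; apply: eq_bigr => a _; rewrite !ffunE.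
have [g0|g0] := leP 0 (gamma a).
  by rewrite max_r ?oppr_le0 // mul0r subr0.
by rewrite max_l ?oppr_ge0 ?ltW // mul0r mulNr opprK add0r.
Qed.

Lemma box_max_ge (R : realType) l u gamma (x : rvec R (arcs G)) :
  (forall a, (l a)%:~R <= (x a : R) <= (u a)%:~R) ->
  int_form gamma x <= (box_max l u gamma)%:~R.
Proof.
move=> lxu; rewrite box_maxE /int_form /int_dot rmorph_sum /=.
apply: ler_sum => a _; rewrite ffunE intrM; have /andP[la au] := lxu a.
have [g0|g0] := leP 0 (gamma a); first by rewrite ler_wpM2l ?ler0z.
by rewrite ler_wnM2l // lerz0 ltW.
Qed.

End Box.

Section Pesp.
Context (R : realType) (X : pesp R).
Local Notation G := (graph X).
Local Notation T := ((period X)%:R : R).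
Local Notation hi := (box_max (lower X) (upper X)).
Implicit Types (gamma : {ffun arcs G -> int}).

Lemma period_gt0 : 0 < T.
Proof. by rewrite ltr0n (leq_trans _ (period_ge2 X)). Qed.

(** The minimum over the box is minus the maximum for [- gamma], and a ceiling is the negated floor
    of the negative; so the lower bound is the upper bound for [- gamma]. *)
Lemma cycle_inequalityE gamma (x : rvec R (arcs G)) :
  cycle_inequality X gamma x <->
  int_form (- gamma) x / T <= (Num.floor ((hi (- gamma))%:~R / T))%:~R /\
  int_form gamma x / T <= (Num.floor ((hi gamma)%:~R / T))%:~R.
Proof.
have -> : hi (- gamma) = - (int_dot (pos_part gamma) (lower X)
                            - int_dot (neg_part gamma) (upper X)).
  by rewrite /box_max pos_partN neg_partN opprB.
rewrite /cycle_inequality ceilNfloor int_formN -mulNr !rmorphN /= mulNr.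
by rewrite lerNl mulNr; split=> [/andP|[-> ->]].
Qed.

Context (B : {fset {ffun arcs G -> int}}).
Implicit Types (c : {ffun B -> int}) (xz : rvec R (arcs G) * rvec R B).

Lemma ZcombE c a : Zcomb c a = \sum_(b : B) fsval b a * c b.
Proof.
rewrite /Zcomb sum_ffunE; apply: eq_bigr => b _.
by rewrite ffunMzE mulrzz.
Qed.

Lemma cycle_space_Zcomb c :
  (forall gamma, gamma \in B -> cycle_space gamma) -> cycle_space (Zcomb c).
Proof.
move=> cB i; under eq_bigr do rewrite ZcombE.
under [RHS]eq_bigr do rewrite ZcombE.
rewrite exchange_big [RHS]exchange_big /=; apply: eq_bigr => b _.
by rewrite -!mulr_suml (cB _ (fsvalP b) i).
Qed.

Lemma int_form_Zcomb c (x : rvec R (arcs G)) :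
  int_form (Zcomb c) x = \sum_b (c b)%:~R * int_form (cycle_matrix b) x.
Proof.
rewrite /int_form; under eq_bigr do rewrite ZcombE rmorph_sum /= mulr_suml.
rewrite exchange_big /=; apply: eq_bigr => b _; rewrite mulr_sumr.
by apply: eq_bigr => a _; rewrite intrM mulrAC mulrC mulrA.
Qed.

(** The equations [Gamma x = T z] determine [z] from [x], so a form in the integer variables becomes
    a form in [x]. *)
Lemma pesp_int_form c xz : pesp_polyhedron X B xz ->
  int_form c xz.2 = int_form (Zcomb c) xz.1 / T.
Proof.
case=> Gx _; rewrite int_form_Zcomb mulr_suml; apply: eq_bigr => b _.
by rewrite Gx [RHS]mulrC [in RHS](mulrCA _ T) mulKf // gt_eqF ?period_gt0.
Qed.

Lemma convex_pesp_polyhedron : convex_set (pesp_polyhedron X B).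
Proof.
move=> x y t; rewrite !inE => -[Gx bx] [Gy bly].
split=> [b|a].
  rewrite /= int_form_lincomb Gx Gy !ffunE mulrDr.
  by congr (_ + _); exact: mulrCA.
have /andP[lx xu] := bx a; have /andP[ly yu] := bly a.
have t01 : 0 <= t%:num <= 1 by rewrite ge0 le1.
rewrite !ffunE weighted_mean_le // andbT -lerN2 opprD -!mulrN.
by rewrite weighted_mean_le // lerN2.
Qed.

(* Forward direction: the box vertex x maximizing [Zcomb c] lifts to (x, Gamma x / T) in P. *)
Lemma pesp_above_eq0 c (beta0 : int) xz : pesp_polyhedron X B xz ->
  above (pesp_polyhedron X B) c beta0 = set0 <->
  Num.floor ((hi (Zcomb c))%:~R / T) <= beta0.
Proof.
(* As [beta0] is an integer, the floor condition says that the maximum divided by [T] is strictly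
   below [beta0 + 1], the threshold of [above]. *)
move=> [_ bx]; rewrite -ltzD1 floor_lt_int; split=> [aE|lthi].
  pose x : rvec R (arcs G) :=
    [ffun a => (box_argmax (lower X) (upper X) (Zcomb c) a)%:~R].
  pose z : rvec R B := [ffun b => int_form (cycle_matrix b) x / T].
  have Pxz : pesp_polyhedron X B (x, z).
    split=> [b|a] /=; rewrite !ffunE.
      by rewrite mulrC mulfVK // gt_eqF ?period_gt0.
    (* The given point of the polyhedron shows [l <= u], so the chosen vertex lies in the box. *)
    have /andP[lx xu] := bx a; have lu := le_trans lx xu.
    by case: ifP; rewrite lexx lu.
  have hiE : int_form (Zcomb c) x = (hi (Zcomb c))%:~R.
    rewrite box_maxE /int_form /int_dot rmorph_sum /=.
    by apply: eq_bigr => a _; rewrite ffunE intrM.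
  rewrite -hiE -(pesp_int_form c Pxz) ltNge; apply/negP => ge_b.
  by have : above (pesp_polyhedron X B) c beta0 (x, z) by []; rewrite aE.
rewrite -subset0 => yz [Pyz] /=; apply/negP.
rewrite -ltNge (le_lt_trans _ lthi) // (pesp_int_form _ Pyz).
by rewrite ler_pM2r ?invr_gt0 ?period_gt0 // box_max_ge //; case: Pyz.
Qed.

End Pesp.

Theorem theorem3p3 (R : realType) (X : pesp R)
    (B : {fset {ffun arcs (graph X) -> int}}) (hB : integral_cycle_basis B) :
  chvatal_closure (pesp_polyhedron X B) =
  [set xz | pesp_polyhedron X B xz /\
            forall gamma : {ffun arcs (graph X) -> int},
              cycle_space gamma -> cycle_inequality X gamma xz.1].
Proof.
case: hB => _ cB spanB _; apply/seteqP; split=> xz.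
  move=> /(chvatal_closureP _ (convex_pesp_polyhedron (B := B)))[Pxz Hxz].
  have valid gamma : cycle_space gamma -> int_form gamma xz.1 / (period X)%:R <=
      (Num.floor ((box_max (lower X) (upper X) gamma)%:~R / (period X)%:R : R))%:~R.
    (* Integrality of the basis makes [c] an integer vector, hence an admissible split normal, with
       the floor as [beta0]. *)
    move=> /spanB[c ->]; rewrite -pesp_int_form //.
    by apply: Hxz; apply/(pesp_above_eq0 _ _ Pxz).
  split=> // gamma Cg; apply/cycle_inequalityE; split; apply: valid => //.
  by move=> i; under eq_bigr do rewrite ffunE; under [RHS]eq_bigr do rewrite ffunE;
     rewrite !sumrN Cg.
move=> [Pxz Cxz]; apply/chvatal_closureP; first exact: convex_pesp_polyhedron.
split=> // c beta0 /(pesp_above_eq0 _ _ Pxz) le_hi.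
(* Conversely, each split normal [c] yields a cycle space element, whose upper bound is at least as
   strong as [beta0]. *)
have cZ : cycle_space (Zcomb c) by apply: cycle_space_Zcomb => g /cB[].
have /cycle_inequalityE[_ le_floor] := Cxz _ cZ.
by rewrite (pesp_int_form _ Pxz) (le_trans le_floor) // ler_int.
Qed.
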